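(* Let $E$ be a Dedekind complete Riesz space with weak order unit $e$, where $e$ is taken as the multiplicative unit in the $f$-algebra $E^u$. For all $x,y\in E^u$ and all real $p$ with $1\le p\le 2$, $$|x+y|^p+|x-y|^p\le 2\left(|x|^p+|y|^p\right).$$
   Context: $E^u$ denotes the universal completion of the Archimedean Riesz space $E$ (the universally complete Riesz space, unique up to Riesz isomorphism, containing $E$ as an order dense Riesz subspace). It is an $f$-algebra for the multiplication having the chosen weak order unit $e$ as algebraic unit. For $f\in E^u_+$ and $p\geq 1$, the power $f^p\in E^u_+$ is defined by functional calculus (with respect to the unit $e$). *)

(* Defs.v *)
From HB Require Import structures.
From mathcomp Require Import all_boot all_order all_algebra.
From mathcomp Require Import boolp classical_sets functions reals exp.

Set Implicit Arguments.
Unset Strict Implicit.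
Unset Printing Implicit Defensive.

Import Order.TTheory GRing.Theory Num.Theory.

Local Open Scope classical_set_scope.
Local Open Scope ring_scope.

(* A Riesz space: an ordered vector space in which any two elements x, y have a
   supremum [rsup x y] and an infimum [rinf x y]. *)
HB.mixin Record POrderedLmodule_isRiesz (R : numDomainType) V
    of GRing.Lmodule R V & Num.POrderedZmodule V := {
  rsup : V -> V -> V;
  rinf : V -> V -> V;
  rsup_le : forall x y z : V, (rsup x y <= z) = (x <= z) && (y <= z);
  le_rinf : forall x y z : V, (z <= rinf x y) = (z <= x) && (z <= y);
  riesz_leD2r : forall z x y : V, x <= y -> x + z <= y + z;
  riesz_scale_ge0 : forall (a : R) (x : V), 0 <= a -> 0 <= x -> 0 <= a *: x
}.

#[short(type="rieszType")]
HB.structure Definition Riesz (R : numDomainType) :=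
  { V of GRing.Lmodule R V & Num.POrderedZmodule V
       & POrderedLmodule_isRiesz R V }.

Section RieszSpaces.
Context {R : realType}.
Implicit Types E U : rieszType R.

Definition rpos E (x : E) : E := rsup x 0.
Definition rabs E (x : E) : E := rsup x (- x).
Definition rdisjoint E (x y : E) : Prop := rinf (rabs x) (rabs y) = 0.

Definition dedekind_complete E : Prop :=
  forall A : set E, A !=set0 -> has_ubound A -> supremums A !=set0.

(* A nonempty: in the positive cone the empty family has supremum 0, whereas
   [supremums set0] asks for a least element of the whole space. *)
Definition laterally_complete E : Prop :=
  forall A : set E, A !=set0 -> (forall a, A a -> 0 <= a) ->
    (forall a b, A a -> A b -> a <> b -> rdisjoint a b) ->
    supremums A !=set0.

Definition universally_complete E : Prop :=
  dedekind_complete E /\ laterally_complete E.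

Definition weak_order_unit E (e : E) : Prop :=
  0 <= e /\ forall x : E, rdisjoint x e -> x = 0.

Record riesz_embedding E U (i : {linear E -> U}) : Prop := {
  riesz_embedding_inj : injective i;
  riesz_embedding_sup : forall x y : E, i (rsup x y) = rsup (i x) (i y);
  riesz_embedding_inf : forall x y : E, i (rinf x y) = rinf (i x) (i y)
}.

(* (U, i) is a universal completion of E; it is unique up to Riesz isomorphism
   over E, so E^u is rendered by an arbitrary such pair. *)
Record universal_completion E U (i : {linear E -> U}) : Prop := {
  ucompl_complete : universally_complete U;
  ucompl_embedding : riesz_embedding i;
  ucompl_order_dense :
    forall u : U, 0 < u -> exists x : E, 0 < i x /\ i x <= u
}.

Record f_algebra U (mul : U -> U -> U) (one : U) : Prop := {
  falg_mulA : forall x y z, mul x (mul y z) = mul (mul x y) z;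
  falg_mulDl : forall x y z, mul (x + y) z = mul x z + mul y z;
  falg_mulDr : forall x y z, mul x (y + z) = mul x y + mul x z;
  falg_scalel : forall (a : R) x y, mul (a *: x) y = a *: mul x y;
  falg_scaler : forall (a : R) x y, mul x (a *: y) = a *: mul x y;
  falg_mul1x : forall x, mul one x = x;
  falg_mulx1 : forall x, mul x one = x;
  falg_mul_ge0 : forall x y, 0 <= x -> 0 <= y -> 0 <= mul x y;
  falg_mul_disjoint : forall x y z, rinf x y = 0 -> 0 <= z ->
    rinf (mul z x) y = 0 /\ rinf (mul x z) y = 0
}.

(* For g, x >= 0 in a Dedekind complete space, the projection
   P_g x = sup_n (x /\ n g) of x onto the band generated by g. *)
Definition band_proj U (g x : U) : U :=
  supremum 0 [set rinf x (n%:R *: g) | n in [set: nat]].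

(* The right-continuous spectral system of f with respect to e; in a space of
   functions with e = 1 it is the indicator of {f <= t}. *)
Definition spectral U (e f : U) (t : R) : U :=
  e - band_proj (rpos (f - t *: e)) e.

(* The integrals of the step functions sum_i a_i 1_(t_i, t_(i+1)] whose i-th
   value is at most phi on (t_i, t_(i+1)], against the spectral system of f. *)
Definition lower_sums U (e : U) (phi : R -> R) (f : U) : set U :=
  [set v | exists (n : nat) (t a : nat -> R),
    [/\ forall i, (i < n)%N -> t i < t i.+1,
        forall i s, (i < n)%N -> t i < s -> s <= t i.+1 -> a i <= phi s
      & v = \sum_(i < n) a i *: (spectral e f (t i.+1) - spectral e f (t i))]].

(* Functional calculus phi(f) = \int phi(t) d(spectral e f t) as a supremum of
   lower sums; meant for continuous phi >= 0, in a universally complete space. *)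
Definition fun_calc U (e : U) (phi : R -> R) (f : U) : U :=
  supremum 0 (lower_sums e phi f).

(* Meant for f >= 0; then [spectral e f t] vanishes for t < 0, and the values
   of [powR] at negative arguments do not contribute. *)
Definition rpow U (e f : U) (p : R) : U := fun_calc e (fun t => powR t p) f.

End RieszSpaces.

(* Main.v *)
Require Import Defs.
From HB Require Import structures.
From mathcomp Require Import all_boot all_order all_algebra.
From mathcomp Require Import boolp classical_sets functions reals sequences exp.
From mathcomp Require Import ring lra.

(** For real numbers and [r = p / 2], concavity of [t |-> t ^ r] says that
    [t ^ p = (t ^ 2) ^ r] is the infimum over [s > 0] of the quadratics
    [r s^(r-1) t^2 + (1-r) s^r], the tangents of [w |-> w ^ r] read at
    [w = t^2].  The same formula holds in the f-algebra, with scalar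
    parameters [s] only:
      [f^p = inf_(s > 0) (r s^(r-1) f^2 + (1-r) s^r e)]   for [f >= 0].
    It turns the theorem into an algebraic one: by the parallelogram law
    [(x+y)^2 + (x-y)^2 = 2 (x^2 + y^2)], taking the parameter [s + t] for
    both terms on the left bounds them together by
      [2 (r (s+t)^(r-1) (x^2 + y^2) + (1-r) (s+t)^r e)].
    Since [s |-> s^(r-1)] is nonincreasing and [s |-> s^r] subadditive, this is
    at most twice the sum of the quadratic of parameter [s] at [x] and the
    one of parameter [t] at [y]; the infimum over [s] and [t] separately is
    the right-hand side.

    The formula for [f^p] has two halves.  Every lower sum lies below each
    quadratic ([lower_sums_le]), because on the cell [q] of the spectral system
    between [s] and [t] one has [s q <= f q <= t q]; this also supplies the
    upper bound that Dedekind completeness needs for [f^p] to be a genuine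
    supremum.  Conversely an element [z] below all the quadratics lies
    below [f^p] ([le_rpow]): on each cell of a fine grid, the quadratic that
    touches [t ^ p] near the cell compares [z] with the lower sum over the grid,
    and the Archimedean property absorbs both the mesh and the part of [z] that
    lives where [f] is large. *)

Set Implicit Arguments.
Unset Strict Implicit.

Import Order.TTheory GRing.Theory Num.Theory.

Local Open Scope ring_scope.

(** * Inequalities between real powers *)

Section RealPowers.
Context {R : realType}.
Implicit Types w s t u v p r d : R.

(** A concave function lies below its tangent.  After division by [w ^ r], and
    with [l = ln w - ln s], this is
    [1 <= r exp ((1 - r) l) + (1 - r) exp (- r l)], where
    [1 + x <= exp x] makes the terms of order one cancel. *)
Lemma powR_le_tangent r s w : 0 < r <= 1 -> 0 < s -> 0 <= w ->
  powR w r <= r * powR s (r - 1) * w + (1 - r) * powR s r.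
Proof.
move=> /andP[r0 r1] s0; rewrite le_eqVlt => /predU1P[<-|w0].
  by rewrite powR0 ?gt_eqF// mulr0 add0r mulr_ge0 ?powR_ge0 ?subr_ge0.
have sE : powR s (r - 1) * w = powR w r * expR ((1 - r) * (ln w - ln s)).
  rewrite -{1}(lnK w0) /powR !gt_eqF// -!expRD; congr expR; ring.
have tE : powR s r = powR w r * expR (r * (ln s - ln w)).
  rewrite /powR !gt_eqF// -!expRD; congr expR; ring.
rewrite -mulrA sE tE.
have W0 := powR_gt0 r w0.
have h1 := expR_ge1Dx ((1 - r) * (ln w - ln s)).
have h2 := expR_ge1Dx (r * (ln s - ln w)).
have : 1 <= r * expR ((1 - r) * (ln w - ln s)) + (1 - r) * expR (r * (ln s - ln w)).
  apply: le_trans (lerD (ler_wpM2l (ltW r0) h1) (ler_wpM2l _ h2)); last by lra.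
  by rewrite le_eqVlt; apply/orP; left; apply/eqP; ring.
by move=> /(ler_wpM2l (ltW W0)); rewrite mulr1 mulrDr !(mulrCA (powR w r)).
Qed.

(** The convex function [t |-> t ^ p] lies above its tangent at [s]: apply the
    concave case to the exponent [p^-1] at the points [u ^ p] and [s ^ p]. *)
Lemma powR_le_secant p s u : 1 <= p -> 0 < s -> 0 <= u ->
  powR s p - powR u p <= p * powR s (p - 1) * (s - u).
Proof.
move=> p1 s0 u0; have p0 : 0 < p by lra.
have pV : 0 < p^-1 <= 1 by rewrite invr_gt0 p0 invf_le1.
have S0 := powR_gt0 (p - 1) s0.
have := powR_le_tangent pV (powR_gt0 p s0) (powR_ge0 u p).
rewrite -!powRrM mulrBr mulfV ?gt_eqF// mulr1 !powRr1 ?(ltW s0)// => h.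
have sE : powR s (1 - p) * powR s (p - 1) = 1.
  by rewrite -(opprB p) powRN mulVf ?gt_eqF.
have := mulr_powRB1 (ltW s0) p0.
have := ler_wpM2l (mulr_ge0 (ltW p0) (ltW S0)) h.
set A := powR s (1 - p) in sE *; set B := powR s (p - 1) in sE S0 *.
set U := powR u p; set S := powR s p.
have -> : p * B * (p^-1 * A * U + (1 - p^-1) * s) =
   (p * p^-1) * (A * B) * U + (p - p * p^-1) * (s * B) by ring.
rewrite sE mulfV ?gt_eqF// => h' sB; rewrite sB in h'.
have -> : p * B * (s - u) = p * (s * B) - p * B * u by ring.
rewrite sB; lra.
Qed.

Lemma powR_le_affine r w : 0 <= r <= 1 -> 0 <= w -> powR w r <= 1 + w.
Proof.
move=> /andP[r0 r1] w0; have [w1|w1] := leP w 1.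
  have := @ge0_ler_powR _ r r0 w 1; rewrite !nnegrE powR1 => /(_ w0 ler01 w1).
  by lra.
by have := ler1_powR (ltW w1) r1; lra.
Qed.

(** A modulus of continuity that is explicit in the mesh [d], uniform in [p], and
    grows only linearly with [s]. *)
Lemma powR_sub_le p d s u : 1 <= p <= 2 -> 0 < s -> 0 <= u -> s - u <= 2 * d ->
  0 <= d ->
  powR s p <= powR u p + 4 * d * (1 + s).
Proof.
move=> /andP[p1 p2] s0 u0 sud d0.
have h := powR_le_secant p1 s0 u0.
have pB : 0 <= p - 1 <= 1 by lra.
have a := powR_le_affine pB (ltW s0).
have b := powR_ge0 s (p - 1).
have : p * powR s (p - 1) * (s - u) <= 2 * (1 + s) * (2 * d).
  apply: le_trans (ler_wpM2l _ sud) _; first by rewrite mulr_ge0//; lra.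
  by apply: ler_wpM2r; [lra|apply: ler_pM => //; lra].
by lra.
Qed.

Lemma powRB1_anti r s t : r <= 1 -> 0 < s -> s <= t ->
  powR t (r - 1) <= powR s (r - 1).
Proof.
move=> r1 s0 st; have t0 : 0 < t by lra.
rewrite /powR !gt_eqF// ler_expR ler_wnM2l ?ler_ln//; lra.
Qed.

Lemma powR_subadd r s t : 0 < r <= 1 -> 0 < s -> 0 < t ->
  powR (s + t) r <= powR s r + powR t r.
Proof.
move=> /andP[r0 r1] s0 t0.
have st0 : 0 < s + t by lra.
rewrite -(mulr_powRB1 (ltW s0) r0) -(mulr_powRB1 (ltW t0) r0).
rewrite -(mulr_powRB1 (ltW st0) r0) mulrDl.
by rewrite lerD// ler_wpM2l ?powRB1_anti ?(ltW s0) ?(ltW t0)//; lra.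
Qed.

(** Lower sums constrain their coefficients on half-open cells only; continuity
    carries the bound to the excluded left end point. *)
Lemma quadratic_right_limit (a b c s t : R) : 0 <= a -> 0 <= s -> s < t ->
  (forall u, s < u -> u <= t -> c <= a * u ^+ 2 + b) -> c <= a * s ^+ 2 + b.
Proof.
move=> a0 s0 st H; rewrite leNgt; apply/negP => cs.
pose K := a * (s + t); have K0 : 0 <= K by rewrite mulr_ge0//; lra.
pose g := c - (a * s ^+ 2 + b); have g0 : 0 < g by rewrite subr_gt0.
have [h [h0 ht hg]] : exists h : R, [/\ 0 < h, s + h <= t & K * h < g].
  exists (Num.min (t - s) (g / (K + 1))).
  have q0 : 0 < g / (K + 1) by rewrite divr_gt0//; lra.
  split; first by rewrite lt_min q0 subr_gt0 st.
    by rewrite -lerBrDl ge_min lexx.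
  apply: (@le_lt_trans _ _ (K * (g / (K + 1)))).
    by rewrite ler_wpM2l// ge_min lexx orbT.
  by rewrite mulrA ltr_pdivrMr; lra.
have c1 := H (s + h) ltac:(lra) ht.
have : a * (s + h) ^+ 2 <= a * s ^+ 2 + K * h.
  have -> : a * (s + h) ^+ 2 = a * s ^+ 2 + a * (s + (s + h)) * h by ring.
  rewrite lerD2l; apply: ler_wpM2r; [lra|]; apply: ler_wpM2l; lra.
move: hg; rewrite /g; lra.
Qed.

End RealPowers.

Section Touching.
Context {R : realType}.
Implicit Types p s t : R.

(** Coefficients of [t |-> touch_lead p s * t ^+ 2 + touch_const p s], the tangent
    of [w |-> w ^ (p / 2)] at [s] evaluated at [w = t ^+ 2]. *)
Definition touch_lead p s : R := p / 2 * powR s (p / 2 - 1).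
Definition touch_const p s : R := (1 - p / 2) * powR s (p / 2).

Lemma touch_lead_ge0 p s : 0 <= p -> 0 <= touch_lead p s.
Proof. by move=> p0; rewrite mulr_ge0 ?powR_ge0//; lra. Qed.

Lemma touch_const_ge0 p s : p <= 2 -> 0 <= touch_const p s.
Proof. by move=> p2; rewrite mulr_ge0 ?powR_ge0//; lra. Qed.

Lemma powR_half_sqr p t : 0 <= t -> powR (t ^+ 2) (p / 2) = powR t p.
Proof.
move=> t0; rewrite -powR_mulrn// -powRrM; congr powR; lra.
Qed.

(** The quadratics lie above [t ^ p], and [touch_eq] says that the one of parameter
    [t ^ 2] touches it at [t]; together they express [t ^ p] as an infimum. *)
Lemma powR_le_touch p s t : 0 < p <= 2 -> 0 < s -> 0 <= t ->
  powR t p <= touch_lead p s * t ^+ 2 + touch_const p s.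
Proof.
move=> p12 s0 t0; rewrite -powR_half_sqr//; apply: powR_le_tangent => //; last first.
  exact: exprn_ge0.
by lra.
Qed.

Lemma touch_eq p t : 0 < p -> 0 < t ->
  touch_lead p (t ^+ 2) * t ^+ 2 + touch_const p (t ^+ 2) = powR t p.
Proof.
move=> p0 t0; have p20 : 0 < p / 2 by lra.
have := mulr_powRB1 (ltW (exprn_gt0 2 t0)) p20.
rewrite /touch_lead /touch_const powR_half_sqr ?ltW// => h.
by rewrite -mulrA (mulrC (powR _ _)) h; ring.
Qed.

Lemma touch_leadD p s t : 0 < p <= 2 -> 0 < s -> 0 <= t ->
  touch_lead p (s + t) <= touch_lead p s.
Proof.
move=> p02 s0 t0; apply: ler_wpM2l; first by lra.
by apply: powRB1_anti => //; lra.
Qed.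

Lemma touch_constD p s t : 0 < p <= 2 -> 0 < s -> 0 < t ->
  touch_const p (s + t) <= touch_const p s + touch_const p t.
Proof.
move=> p02 s0 t0; rewrite /touch_const -mulrDr; apply: ler_wpM2l; first by lra.
by apply: powR_subadd => //; lra.
Qed.

End Touching.

(** * Riesz spaces and band projections *)

Section RieszTheory.
Context {R : realType} {U : rieszType R}.
Implicit Types x y z w g h e : U.

Lemma riesz_leD x y z w : x <= y -> z <= w -> x + z <= y + w.
Proof.
move=> xy zw; apply: (le_trans (riesz_leD2r z _ _ xy)).
by rewrite ![y + _]addrC riesz_leD2r.
Qed.

Lemma riesz_subr_ge0 x y : (0 <= y - x) = (x <= y).
Proof.
apply/idP/idP => [/(riesz_leD2r x _ _)|/(riesz_leD2r (- x) _ _)].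
  by rewrite add0r subrK.
by rewrite subrr.
Qed.

Lemma riesz_lerBlDr x y z : (x - y <= z) = (x <= z + y).
Proof. by rewrite -[LHS]riesz_subr_ge0 opprB addrA riesz_subr_ge0. Qed.

Lemma riesz_lerBrDr x y z : (x <= y - z) = (x + z <= y).
Proof. by rewrite -[LHS]riesz_subr_ge0 -addrA -opprD riesz_subr_ge0 addrC. Qed.

Lemma riesz_addr_ge0 x y : 0 <= x -> 0 <= y -> 0 <= x + y.
Proof. by move=> x0 y0; rewrite -(addr0 0); exact: riesz_leD. Qed.

Lemma riesz_scale_le (a : R) x y : 0 <= a -> x <= y -> a *: x <= a *: y.
Proof.
by move=> a0 xy; rewrite -riesz_subr_ge0 -scalerBr riesz_scale_ge0// riesz_subr_ge0.
Qed.

Lemma riesz_scale_leV (a : R) x y : 0 < a -> a *: x <= a *: y -> x <= y.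
Proof.
move=> a0 /(riesz_scale_le (a := a^-1)); rewrite !scalerA mulVf ?gt_eqF// !scale1r.
by apply; rewrite invr_ge0 ltW.
Qed.

Lemma riesz_scale_le2 (a b : R) x : 0 <= x -> a <= b -> a *: x <= b *: x.
Proof.
by move=> x0 ab; rewrite -riesz_subr_ge0 -scalerBl riesz_scale_ge0// subr_ge0.
Qed.

Lemma rsup_ubl x y : x <= rsup x y.
Proof. by have := lexx (rsup x y); rewrite rsup_le => /andP[]. Qed.

Lemma rsup_ubr x y : y <= rsup x y.
Proof. by have := lexx (rsup x y); rewrite rsup_le => /andP[]. Qed.

Lemma rinf_lbl x y : rinf x y <= x.
Proof. by have := lexx (rinf x y); rewrite le_rinf => /andP[]. Qed.

Lemma rinf_lbr x y : rinf x y <= y.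
Proof. by have := lexx (rinf x y); rewrite le_rinf => /andP[]. Qed.

Lemma rinf_greatest x y z : z <= x -> z <= y -> z <= rinf x y.
Proof. by move=> zx zy; rewrite le_rinf zx zy. Qed.

Lemma rinfC x y : rinf x y = rinf y x.
Proof. by apply/le_anti; rewrite !rinf_greatest ?rinf_lbl ?rinf_lbr. Qed.

Lemma rpos_ge0 x : 0 <= rpos x. Proof. exact: rsup_ubr. Qed.

Lemma le_rpos x : x <= rpos x. Proof. exact: rsup_ubl. Qed.

Lemma rpos_mono x y : x <= y -> rpos x <= rpos y.
Proof. by move=> xy; rewrite /rpos rsup_le rpos_ge0 (le_trans xy (le_rpos y)). Qed.

(** Written as a difference rather than as [rpos (- x)], so that the decomposition
    of [x] is immediate and only disjointness has to be proved. *)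
Definition rneg x : U := rpos x - x.

Lemma rneg_ge0 x : 0 <= rneg x.
Proof. by rewrite riesz_subr_ge0 le_rpos. Qed.

Lemma rposBneg x : x = rpos x - rneg x.
Proof. by rewrite /rneg opprB addrC subrK. Qed.

(** If [d] lies below both parts of [x], then [rpos x - d] is still an upper bound
    of [x] and [0]. *)
Lemma rpos_neg_disjoint x : rinf (rpos x) (rneg x) = 0.
Proof.
apply/le_anti; rewrite rinf_greatest ?rpos_ge0 ?rneg_ge0// andbT.
set d := rinf _ _.
have : rpos x <= rpos x - d.
  rewrite {1}/rpos rsup_le riesz_subr_ge0 rinf_lbl andbT.
  by rewrite riesz_lerBrDr addrC -riesz_lerBrDr rinf_lbr.
by rewrite riesz_lerBrDr addrC -riesz_lerBrDr subrr.
Qed.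

Lemma rabsE x : rabs x = rpos x + rneg x.
Proof.
have tw y : y + y = (2 : R) *: y by rewrite scaler_nat mulr2n.
apply/le_anti/andP; split.
  rewrite /rabs rsup_le; apply/andP; split.
    apply: le_trans (le_rpos x) _.
    by rewrite -riesz_subr_ge0 addrAC subrr add0r rneg_ge0.
  rewrite {1}(rposBneg x) opprB riesz_lerBlDr addrAC -[X in X <= _]add0r.
  by apply: riesz_leD2r; rewrite riesz_addr_ge0 ?rpos_ge0.
have a1 : x <= rabs x := rsup_ubl x (- x).
have a2 : - x <= rabs x := rsup_ubr x (- x).
rewrite /rneg addrA riesz_lerBlDr tw.
suff : rpos x <= (2^-1 : R) *: (rabs x + x).
  move=> /(riesz_scale_le (a := 2)) => /(_ (ler0n _ _)).
  by rewrite scalerA mulfV ?scale1r ?pnatr_eq0.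
have half y : y <= rabs x + x -> (2^-1 : R) *: y <= (2^-1 : R) *: (rabs x + x).
  by apply: riesz_scale_le; rewrite invr_ge0 ler0n.
rewrite /rpos rsup_le; apply/andP; split.
  rewrite -[X in X <= _]scale1r.
  rewrite -[X in X *: x <= _](mulVf (_ : (2 : R) != 0)) ?pnatr_eq0//.
  by rewrite -scalerA half// -tw riesz_leD2r.
have := half 0; rewrite scaler0; apply.
by move: a2; rewrite -(riesz_subr_ge0 (- x)) opprK.
Qed.

Lemma rabs_ge0 x : 0 <= rabs x.
Proof. by rewrite rabsE riesz_addr_ge0 ?rpos_ge0 ?rneg_ge0. Qed.

Lemma le_rabs x : x <= rabs x. Proof. exact: rsup_ubl. Qed.

Lemma rinf_disjointD g h z : 0 <= h -> 0 <= z ->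
  rinf g z <= 0 -> rinf h z <= 0 -> rinf (g + h) z <= 0.
Proof.
move=> h0 z0 gz hz; set d := rinf _ _.
have dg : d - h <= rinf g z.
  apply: rinf_greatest; rewrite riesz_lerBlDr; first exact: rinf_lbl.
  by apply: le_trans (rinf_lbr _ _) _; rewrite -riesz_subr_ge0 addrAC subrr add0r.
apply: le_trans hz; apply: rinf_greatest; last exact: rinf_lbr.
by have := le_trans dg gz; rewrite riesz_lerBlDr add0r.
Qed.

Lemma rinf_disjointMn g z n : 0 <= g -> 0 <= z ->
  rinf g z <= 0 -> rinf (n%:R *: g) z <= 0.
Proof.
move=> g0 z0 gz; elim: n => [|n IH]; first by rewrite scale0r rinf_lbl.
rewrite -natr1 scalerDl scale1r; exact: rinf_disjointD.
Qed.

(** For disjoint [g] and [h] the sum is the supremum; here as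
    [g + h - w <= rinf g h]. *)
Lemma addr_le_of_disjoint g h w : rinf g h <= 0 -> g <= w -> h <= w ->
  g + h <= w.
Proof.
move=> gh gw hw; have : g + h - w <= rinf g h.
  apply: rinf_greatest; rewrite riesz_lerBlDr.
    by rewrite addrC [_ + w]addrC riesz_leD2r.
  by rewrite addrC [h + w]addrC addrC riesz_leD2r.
by move=> /le_trans/(_ gh); rewrite riesz_lerBlDr add0r.
Qed.

Hypothesis dcU : dedekind_complete U.

(** If the multiples of [x] are bounded, their supremum [s] satisfies
    [s + x <= s]. *)
Lemma riesz_archimedean x y : (forall n, n%:R *: x <= y) -> x <= 0.
Proof.
move=> xy; pose A := [set n%:R *: x | n in [set: nat]]%classic.
have [||s [sub slub]] := dcU (A := A).
- by exists (0%:R *: x); exists 0%N.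
- by exists y => _ [n _ <-].
have : s <= s - x.
  apply: slub => _ [n _ <-]; rewrite riesz_lerBrDr -[X in _ + X]scale1r -scalerDl natr1.
  by apply: sub; exists n.+1.
by rewrite riesz_lerBrDr addrC -riesz_lerBrDr subrr.
Qed.

Lemma supremumP (A : set U) (b : U) : (exists a, A a) -> (forall a, A a -> a <= b) ->
  (forall a, A a -> a <= supremum 0 A) /\
  (forall c, (forall a, A a -> a <= c) -> supremum 0 A <= c).
Proof.
move=> A0 Ab; have : supremums A (supremum 0 A).
  have sA : (supremums A !=set0)%classic by apply: dcU => //; exists b.
  rewrite /supremum; case: ifPn => [/eqP E|_]; last by case: sA => s; apply: xgetI.
  by case: A0 => a; rewrite E.
by case=> ub lub; split=> // c Ac; apply: lub.
Qed.

Lemma band_projP g e : 0 <= e ->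
  (forall n, rinf e (n%:R *: g) <= band_proj g e) /\
  (forall c, (forall n, rinf e (n%:R *: g) <= c) -> band_proj g e <= c).
Proof.
move=> e0; rewrite /band_proj.
pose A := [set rinf e (n%:R *: g) | n in [set: nat]]%classic.
have [||H1 H2] := supremumP (A := A) (b := e).
- by exists (rinf e (0%:R *: g)); exists 0%N.
- by move=> _ [n _ <-]; exact: rinf_lbl.
split=> [n|c cn]; first by apply: H1; exists n.
by apply: H2 => _ [n _ <-].
Qed.

Lemma band_proj_ge0 g e : 0 <= e -> 0 <= band_proj g e.
Proof.
move=> e0; have [H _] := band_projP g e0; apply: le_trans (H 0%N).
by rewrite scale0r rinf_greatest.
Qed.

Lemma band_proj_le g e : 0 <= e -> band_proj g e <= e.
Proof.
by move=> e0; have [_ H] := band_projP g e0; apply: H => n; exact: rinf_lbl.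
Qed.

Lemma band_proj_mono g h e : 0 <= e -> g <= h -> band_proj g e <= band_proj h e.
Proof.
move=> e0 gh; have [_ H] := band_projP g e0; apply: H => n.
have [H' _] := band_projP h e0; apply: le_trans (H' n).
apply: rinf_greatest; first exact: rinf_lbl.
by apply: le_trans (rinf_lbr _ _) _; apply: riesz_scale_le.
Qed.

(** Disjointness from [h] passes to the supremum [c] of the approximations
    [c_n = rinf e (n g)]: with [d = rinf c h], the disjoint [c_n] and [d] both lie
    below [c], hence so does [c_n + d], and [c - d] is already an upper bound. *)
Lemma band_proj_disjoint g h e : 0 <= e -> 0 <= g -> 0 <= h -> rinf g h = 0 ->
  rinf (band_proj g e) h = 0.
Proof.
move=> e0 g0 h0 gh; apply/le_anti; rewrite rinf_greatest ?band_proj_ge0// andbT.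
have [H1 H2] := band_projP g e0; set d := rinf _ _.
suff : band_proj g e <= band_proj g e - d.
  by rewrite riesz_lerBrDr addrC -riesz_lerBrDr subrr.
apply: H2 => n; rewrite riesz_lerBrDr; apply: addr_le_of_disjoint (H1 n) _.
  apply: le_trans (_ : rinf (n%:R *: g) h <= 0).
    apply: rinf_greatest; first exact: le_trans (rinf_lbl _ _) (rinf_lbr _ _).
    exact: le_trans (rinf_lbr _ _) (rinf_lbr _ _).
  by apply: rinf_disjointMn => //; rewrite gh.
exact: rinf_lbl.
Qed.

(** With [c_n = rinf e (n g)] and [d] below both [g] and [e - c], the element
    [c_n + d] lies below [e] and below [(n + 1) g], so that [c_n + d <= c_(n+1)];
    passing to the supremum, [c + d <= c]. *)
Lemma band_proj_compl_disjoint g e : 0 <= e -> 0 <= g ->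
  rinf g (e - band_proj g e) = 0.
Proof.
move=> e0 g0; apply/le_anti.
rewrite rinf_greatest// ?riesz_subr_ge0 ?band_proj_le// andbT.
have [H1 H2] := band_projP g e0; set d := rinf _ _.
suff : band_proj g e <= band_proj g e - d.
  by rewrite riesz_lerBrDr addrC -riesz_lerBrDr subrr.
apply: H2 => n; rewrite riesz_lerBrDr; apply: le_trans (H1 n.+1).
apply: rinf_greatest; last first.
  rewrite -natr1 scalerDl scale1r; apply: riesz_leD (rinf_lbr _ _) (rinf_lbl _ _).
by apply: le_trans (riesz_leD (H1 n) (rinf_lbr _ _)) _; rewrite addrC subrK.
Qed.

End RieszTheory.

(** * Unital f-algebras and the spectral system *)

Section FAlgebra.
Context {R : realType} {U : rieszType R} {mul : U -> U -> U} {e : U}.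
Hypothesis hmul : f_algebra mul e.
Implicit Types x y z w f q v : U.

Lemma falg_mulNl x y : mul (- x) y = - mul x y.
Proof. by rewrite -scaleN1r (falg_scalel hmul)// scaleN1r. Qed.

Lemma falg_mulNr x y : mul x (- y) = - mul x y.
Proof. by rewrite -scaleN1r (falg_scaler hmul)// scaleN1r. Qed.

Lemma falg_mulBl x y z : mul (x - y) z = mul x z - mul y z.
Proof. by rewrite (falg_mulDl hmul)// falg_mulNl. Qed.

Lemma falg_mulBr x y z : mul x (y - z) = mul x y - mul x z.
Proof. by rewrite (falg_mulDr hmul)// falg_mulNr. Qed.

Lemma falg_mulx0 x : mul x 0 = 0.
Proof. by rewrite -(subrr x) falg_mulBr !subrr. Qed.

Lemma falg_le_l z x y : 0 <= z -> x <= y -> mul z x <= mul z y.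
Proof.
move=> z0 xy; rewrite -riesz_subr_ge0 -falg_mulBr.
by rewrite (falg_mul_ge0 hmul)// riesz_subr_ge0.
Qed.

Lemma falg_le_r z x y : 0 <= z -> x <= y -> mul x z <= mul y z.
Proof.
move=> z0 xy; rewrite -riesz_subr_ge0 -falg_mulBl.
by rewrite (falg_mul_ge0 hmul)// riesz_subr_ge0.
Qed.

(** Multiplying one factor at a time keeps disjointness, so that [mul x y] is
    disjoint first from [y] and then from itself. *)
Lemma falg_disjoint_mul0 x y : 0 <= x -> 0 <= y -> rinf x y = 0 -> mul x y = 0.
Proof.
move=> x0 y0 xy.
have [_ xyy] := falg_mul_disjoint hmul xy y0.
rewrite rinfC in xyy; have [xyxy _] := falg_mul_disjoint hmul xyy x0.
by apply/le_anti; rewrite -{1}xyxy (falg_mul_ge0 hmul)// rinf_greatest.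
Qed.

Lemma falg_mul_rabs x : mul (rabs x) (rabs x) = mul x x.
Proof.
have D := rpos_neg_disjoint x.
have pn := falg_disjoint_mul0 (rpos_ge0 x) (rneg_ge0 x) D.
rewrite rinfC in D; have np := falg_disjoint_mul0 (rneg_ge0 x) (rpos_ge0 x) D.
rewrite rabsE [in RHS](rposBneg x).
move: (rneg x) (rpos x) pn np {D} => n q pn np.
rewrite falg_mulBl !falg_mulBr (falg_mulDl hmul)// !(falg_mulDr hmul)//.
by rewrite pn np addr0 add0r subr0 sub0r opprK.
Qed.

Lemma falg_one_ge0 : 0 <= e.
Proof.
by rewrite -(falg_mulx1 hmul e) -falg_mul_rabs (falg_mul_ge0 hmul)// rabs_ge0.
Qed.

Lemma falg_sqr_ge0 x : 0 <= mul x x.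
Proof. by rewrite -falg_mul_rabs (falg_mul_ge0 hmul)// rabs_ge0. Qed.

(** The cross terms [mul x y] and [mul y x], which may differ, each cancel against
    their own negatives. *)
Lemma falg_parallelogram x y :
  mul (x + y) (x + y) + mul (x - y) (x - y) = (2 : R) *: (mul x x + mul y y).
Proof.
rewrite !falg_mulBl !falg_mulBr !(falg_mulDl hmul)// !(falg_mulDr hmul)//.
rewrite opprB [X in X + _ = _](_ : _ = (mul x x + mul y y) + (mul x y + mul y x)).
  rewrite [X in _ + X = _](_ : _ = (mul x x + mul y y) - (mul x y + mul y x)).
    by rewrite addrACA subrr addr0 scaler_nat mulr2n.
  by rewrite opprD addrACA.
by rewrite addrACA [mul x y + mul y y]addrC addrACA [mul y x + _]addrC.
Qed.

Hypothesis dcU : dedekind_complete U.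

(* In a function space with [e = 1], the indicator of [{f > t}]. *)
Local Notation comp f t := (band_proj (rpos (f - t *: e)) e).

Lemma comp_ge0 f (t : R) : 0 <= comp f t.
Proof. exact/band_proj_ge0/falg_one_ge0. Qed.

Lemma comp_le1 f (t : R) : comp f t <= e.
Proof. exact/band_proj_le/falg_one_ge0. Qed.

Lemma comp_anti f (s t : R) : s <= t -> comp f t <= comp f s.
Proof.
move=> st; apply: band_proj_mono => //; first exact: falg_one_ge0.
apply/rpos_mono; rewrite riesz_lerBlDr addrAC riesz_lerBrDr.
by rewrite addrC [f + _]addrC riesz_leD2r// riesz_scale_le2// falg_one_ge0.
Qed.

(** With [g = f - t e], the negative part of [g] kills the component generated by
    its positive part, whence [g q >= 0] for every [q] below that component. *)
Lemma le_mul_comp f (t : R) q : 0 <= q -> q <= comp f t -> t *: q <= mul f q.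
Proof.
move=> q0 qc; set g := f - t *: e.
have e0 := falg_one_ge0.
have D := rpos_neg_disjoint g.
have := band_proj_disjoint dcU e0 (rpos_ge0 g) (rneg_ge0 g) D.
rewrite rinfC => /(falg_disjoint_mul0 (rneg_ge0 g) (comp_ge0 f t)) hc.
rewrite -riesz_subr_ge0 -[q in t *: q](falg_mul1x hmul) -(falg_scalel hmul).
rewrite -falg_mulBl -/g (rposBneg g) falg_mulBl riesz_subr_ge0.
apply: le_trans (falg_le_l (rneg_ge0 g) qc) _.
by rewrite hc (falg_mul_ge0 hmul)// rpos_ge0.
Qed.

(** The positive part of [f - t e] kills the complement of the component that it
    generates. *)
Lemma mul_le_compl f (t : R) q : 0 <= q -> q <= e - comp f t -> mul f q <= t *: q.
Proof.
move=> q0 qc; set g := f - t *: e.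
have e0 := falg_one_ge0.
have /falg_disjoint_mul0 := band_proj_compl_disjoint dcU e0 (rpos_ge0 g).
rewrite rpos_ge0 riesz_subr_ge0 comp_le1 => /(_ isT isT) gc.
rewrite -riesz_subr_ge0 -[q in t *: q](falg_mul1x hmul) -(falg_scalel hmul).
rewrite -falg_mulBl -opprB -/g falg_mulNl (rposBneg g) falg_mulBl opprB riesz_subr_ge0.
apply: le_trans (falg_le_l (rpos_ge0 g) qc) _.
by rewrite gc (falg_mul_ge0 hmul)// rneg_ge0.
Qed.

Lemma spectralB f (s t : R) : spectral e f t - spectral e f s = comp f s - comp f t.
Proof. by rewrite /spectral opprB addrC addrA subrK. Qed.

Lemma spectralB_ge0 f (s t : R) : s <= t -> 0 <= spectral e f t - spectral e f s.
Proof. by move=> st; rewrite spectralB riesz_subr_ge0 comp_anti. Qed.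

Lemma spectralB_le1 f (s t : R) : spectral e f t - spectral e f s <= e.
Proof.
rewrite spectralB riesz_lerBlDr; apply: le_trans (comp_le1 f s) _.
by rewrite -[X in X <= _]addr0 addrC [e + _]addrC riesz_leD2r// comp_ge0.
Qed.

Lemma le_mul_spectralB f (s t : R) : s <= t ->
  s *: (spectral e f t - spectral e f s) <= mul f (spectral e f t - spectral e f s).
Proof.
move=> st; apply: le_mul_comp; first exact: spectralB_ge0.
rewrite spectralB riesz_lerBlDr -[X in X <= _]addr0 addrC [_ + comp f t]addrC.
by rewrite riesz_leD2r// comp_ge0.
Qed.

Lemma mul_spectralB_le f (s t : R) : s <= t ->
  mul f (spectral e f t - spectral e f s) <= t *: (spectral e f t - spectral e f s).
Proof.
move=> st; apply: mul_le_compl; first exact: spectralB_ge0.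
by rewrite spectralB; apply: riesz_leD2r; exact: comp_le1.
Qed.

Lemma sum_mul_spectralB w f n (t : nat -> R) :
  \sum_(i < n) mul w (spectral e f (t i.+1) - spectral e f (t i)) =
  mul w (spectral e f (t n) - spectral e f (t 0%N)).
Proof.
elim: n => [|n IH]; first by rewrite big_ord0 subrr falg_mulx0.
by rewrite big_ord_recr/= IH -(falg_mulDr hmul) addrC addrA subrK.
Qed.

Lemma riesz_le_sum n (F G : 'I_n -> U) : (forall i, F i <= G i) ->
  \sum_i F i <= \sum_i G i.
Proof.
move=> FG; apply: (big_ind2 (fun x y => x <= y)) => // x y z w; exact: riesz_leD.
Qed.

(** On the part where [f <= t < 0] one would have [0 <= f q <= t q]. *)
Lemma spectral_neg f (t : R) : 0 <= f -> t < 0 -> spectral e f t = 0.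
Proof.
move=> f0 t0; have q0 : 0 <= spectral e f t by rewrite riesz_subr_ge0 comp_le1.
have := mul_le_compl q0 (lexx _); rewrite -/(spectral e f t) => h.
have := le_trans (falg_mul_ge0 hmul f0 q0) h.
rewrite -[t in t *: _]opprK scaleNr -[- (_ *: _)]sub0r riesz_lerBrDr add0r => h'.
apply/le_anti; rewrite q0 andbT.
by apply: (@riesz_scale_leV _ _ (- t)); rewrite ?oppr_gt0// scaler0.
Qed.

(** On the cell [q] above [t_i >= 0] one has [f^2 q >= t_i^2 q], so that a
    quadratic above [phi] bounds the coefficient of [q]; the cells sum to at most
    [e].  Cells below [0] vanish, and a cell containing [0] is controlled
    by the value of the quadratic at [0]. *)
Lemma lower_sums_le (phi : R -> R) (a b : R) f v : 0 <= f -> 0 <= a -> 0 <= b ->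
  (forall t : R, 0 <= t -> phi t <= a * t ^+ 2 + b) ->
  lower_sums e phi f v -> v <= a *: mul f f + b *: e.
Proof.
move=> f0 a0 b0 phi_le [n [t [c [tinc cphi ->]]]].
set W := _ + _.
have W0 : 0 <= W.
  by rewrite riesz_addr_ge0// riesz_scale_ge0// ?falg_sqr_ge0// falg_one_ge0.
apply: (@le_trans _ _ (mul W (spectral e f (t n) - spectral e f (t 0%N)))); last first.
  rewrite -[X in _ <= X](falg_mulx1 hmul); apply: falg_le_l => //.
  exact: spectralB_le1.
rewrite -sum_mul_spectralB; apply: riesz_le_sum => i.
have ti := tinc i (ltn_ord i); have ci := fun s => cphi i s (ltn_ord i).
have q0 := spectralB_ge0 f (ltW ti).
have ql := le_mul_spectralB f (ltW ti).
set q := _ - _ in q0 ql *.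
have WE : mul W q = a *: mul f (mul f q) + b *: q.
  rewrite (falg_mulDl hmul) !(falg_scalel hmul) (falg_mul1x hmul).
  by rewrite -(falg_mulA hmul).
rewrite WE; have [t1|t1] := ltP (t i.+1) 0.
  rewrite /q !spectral_neg ?(lt_trans ti)// subrr.
  by rewrite !falg_mulx0 !scaler0 addr0.
have [t0|t0] := ltP (t i) 0.
  have cb : c i <= b.
    by have := phi_le 0 (lexx 0); have := ci 0 t0 t1; rewrite expr0n/= mulr0; lra.
  apply: le_trans (riesz_scale_le2 q0 cb) _; rewrite -[X in X <= _]add0r riesz_leD2r//.
  by rewrite riesz_scale_ge0// !(falg_mul_ge0 hmul).
apply: (@le_trans _ _ ((a * t i ^+ 2 + b) *: q)).
  apply: riesz_scale_le2 => //; apply: (quadratic_right_limit a0 t0 ti) => s ts st.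
  by apply: le_trans (ci s ts st) (phi_le s _); exact: le_trans t0 (ltW ts).
rewrite scalerDl -scalerA; apply: riesz_leD => //; apply: riesz_scale_le => //.
rewrite expr2 -scalerA.
apply: le_trans (riesz_scale_le t0 ql) _.
by rewrite -(falg_scaler hmul)//; exact: falg_le_l.
Qed.

End FAlgebra.

(** * Powers in a Dedekind complete f-algebra *)

Section Powers.
Context {R : realType} {U : rieszType R} {mul : U -> U -> U} {e : U}.
Hypothesis hmul : f_algebra mul e.
Hypothesis dcU : dedekind_complete U.
Context {p : R}.
Hypotheses (p1 : 1 <= p) (p2 : p <= 2).
Implicit Types x y z w f q v : U.

Let p0 : 0 < p. Proof. exact: lt_le_trans p1. Qed.

Let p02 : 0 < p <= 2. Proof. by rewrite p0. Qed.

(** The quadratic of parameter [1] bounds the lower sums, hence their supremum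
    exists and inherits all the bounds. *)
Lemma rpowP f : 0 <= f ->
  (forall v, lower_sums e (fun t => powR t p) f v -> v <= rpow e f p) /\
  (forall s : R, 0 < s ->
     rpow e f p <= touch_lead p s *: mul f f + touch_const p s *: e).
Proof.
move=> f0; set L := lower_sums _ _ _.
have bound (s : R) : 0 < s -> forall v, L v ->
    v <= touch_lead p s *: mul f f + touch_const p s *: e.
  move=> s0 v; apply: (lower_sums_le hmul dcU f0).
  - exact/touch_lead_ge0/ltW.
  - exact: touch_const_ge0.
  - by move=> t t0; exact: powR_le_touch.
have L0 : exists v, L v.
  by exists 0; exists 0%N, (fun=> 0), (fun=> 0); split=> //; rewrite big_ord0.
have [ub lub] := supremumP dcU L0 (bound 1 ltr01).
by split=> // s s0; apply: lub; exact: bound.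
Qed.

Section Grid.
Variables (f z : U) (m : nat).
Hypothesis f0 : 0 <= f.
Hypothesis zle : forall s : R, 0 < s ->
  z <= touch_lead p s *: mul f f + touch_const p s *: e.
Hypothesis m0 : (0 < m)%N.

(* The points [t 0 = - d], [t 1 = 0], [t 2 = d], and so on up to [t N = m]: starting
   below [0] makes the first spectral element vanish, and the mesh [m ^- 2]
   leaves an error of order [1 / m] once multiplied by the slope of the power. *)
Let d : R := (m%:R ^+ 2)^-1.
Let t (i : nat) : R := (i%:R - 1) * d.
Let N := (m ^ 3).+1.
(* The value of the power at the left end of the cell; the predecessor sends the
   cell that ends at [0] to the coefficient [0]. *)
Let a (i : nat) : R := powR (i.-1%:R * d) p.

Let mR : 1 <= m%:R :> R. Proof. by rewrite ler1n. Qed.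

Let d0 : 0 < d. Proof. by rewrite invr_gt0 exprn_gt0// ltr0n. Qed.

Let t_incr i : t i < t i.+1.
Proof. by rewrite /t ltr_pM2r// -natr1; lra. Qed.

Let tN : t N = m%:R.
Proof.
rewrite /t /N -natr1 addrK /d natrX exprS -mulrA mulfV ?mulr1//.
by rewrite expf_neq0// gt_eqF// ltr0n.
Qed.

Let a_le i s : t i < s -> s <= t i.+1 -> a i <= powR s p.
Proof.
move=> ts st.
case: i ts st => [|i] ts st.
  by rewrite /a mul0r powR0 ?powR_ge0// gt_eqF.
have ti : t i.+1 = i%:R * d by rewrite /t -natr1 addrK.
have i0 : 0 <= i%:R * d by rewrite mulr_ge0// ltW.
apply: (ge0_ler_powR (ltW p0)); rewrite ?nnegrE//.
  by rewrite -ti in i0; exact: le_trans i0 (ltW ts).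
by rewrite -ti ltW.
Qed.

Let powR_grid i : (i < N)%N -> powR (i.+1%:R * d) p <= a i + 12 / m%:R.
Proof.
move=> iN; have m0R : 0 < m%:R :> R by rewrite ltr0n.
have m1R := mR.
have s0 : 0 < i.+1%:R * d by rewrite mulr_gt0// ltr0n.
have v0 : 0 <= i.-1%:R * d by rewrite mulr_ge0// ltW.
have sv : i.+1%:R * d - i.-1%:R * d <= 2 * d.
  rewrite -mulrBl ler_wpM2r ?(ltW d0)// lerBlDr -natrD ler_nat.
  by case: (i).
have sm : i.+1%:R * d <= 2 * m%:R.
  apply: (@le_trans _ _ (N%:R * d)); first by rewrite ler_wpM2r ?(ltW d0)// ler_nat.
  have -> : N%:R * d = t N + d by rewrite /t; ring.
  have : d <= 1 by rewrite invf_le1 ?exprn_gt0// exprn_ege1.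
  by rewrite tN; lra.
have p12 : 1 <= p <= 2 by rewrite p1 p2.
apply: le_trans (powR_sub_le p12 s0 v0 sv (ltW d0)) _; rewrite lerD2l.
have -> : 12 / m%:R = 4 * d * (3 * m%:R) by rewrite /d; field; lra.
by rewrite ler_wpM2l//; [rewrite mulr_ge0// ltW|lra].
Qed.

(** On the cell between [t i] and [t i.+1], compare [z] with the quadratic touching
    at [s = i.+1 * d]; [s] lies one step beyond the cell so that it is positive
    even for the cell that ends at [0]. *)
Lemma grid_cell i : (i < N)%N ->
  mul z (spectral e f (t i.+1) - spectral e f (t i)) <=
  (a i + 12 / m%:R) *: (spectral e f (t i.+1) - spectral e f (t i)).
Proof.
move=> iN; have q0 := spectralB_ge0 hmul dcU f (ltW (t_incr i)).
have fq := mul_spectralB_le hmul dcU f (ltW (t_incr i)).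
set q := _ - _ in q0 fq *.
set s : R := i.+1%:R * d; have s0 : 0 < s by rewrite mulr_gt0// ltr0n.
have t0 : 0 <= t i.+1 by rewrite /t -natr1 addrK mulr_ge0// ltW.
have ts : t i.+1 <= s by rewrite /t /s ler_wpM2r ?(ltW d0)//; lra.
apply: le_trans (falg_le_r hmul q0 (zle (exprn_gt0 2 s0))) _.
rewrite (falg_mulDl hmul) !(falg_scalel hmul) (falg_mul1x hmul) -(falg_mulA hmul).
apply: le_trans (riesz_scale_le2 q0 (powR_grid iN)); rewrite -/s.
rewrite -(touch_eq p0 s0).
rewrite scalerDl -scalerA; apply: riesz_leD => //; apply: riesz_scale_le.
  exact/touch_lead_ge0/ltW.
apply: le_trans (falg_le_l hmul f0 fq) _; rewrite (falg_scaler hmul).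
apply: le_trans (riesz_scale_le t0 fq) _; rewrite scalerA.
by apply: riesz_scale_le2 => //; rewrite expr2 ler_pM.
Qed.

(** The grid covers the part where [f <= m]; there [z] exceeds the lower sum by
    at most [(12 / m) e].  On the remaining component [c] one has [m c <= f], so
    that [z c] is at most [|z| f / m]. *)
Lemma grid_bound :
  m%:R *: (z - rpow e f p) <= mul (rabs z) f + (12 : R) *: e.
Proof.
have m0R : 0 < m%:R :> R by rewrite ltr0n.
have e0 := falg_one_ge0 hmul.
set F := rpow e f p.
pose c := e - spectral e f (t N).
have c0 : 0 <= c by rewrite /c /spectral opprB addrC subrK; exact: (comp_ge0 hmul dcU).
have zc : m%:R *: mul z c <= mul (rabs z) f.
  have zz : mul z c <= mul (rabs z) c by exact: (falg_le_r hmul c0 (le_rabs z)).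
  apply: le_trans (riesz_scale_le (ltW m0R) zz) _; rewrite -(falg_scaler hmul).
  apply: (falg_le_l hmul (rabs_ge0 z)); rewrite -tN.
  have cE : c = band_proj (rpos (f - t N *: e)) e.
    by rewrite /c /spectral opprB addrC subrK.
  apply: le_trans (le_mul_comp hmul dcU c0 _) _; first by rewrite cE.
  rewrite -[X in _ <= X](falg_mulx1 hmul); apply: (falg_le_l hmul) => //.
  by rewrite cE; exact: (comp_le1 hmul dcU).
have S0 : spectral e f (t 0) = 0.
  by apply: (spectral_neg hmul dcU f0); rewrite /t sub0r mulN1r oppr_lt0 d0.
have zs : mul z (spectral e f (t N)) <= F + (12 / m%:R) *: e.
  have -> : spectral e f (t N) = spectral e f (t N) - spectral e f (t 0).
    by rewrite S0 subr0.
  rewrite -(sum_mul_spectralB hmul).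
  apply: le_trans (riesz_le_sum (fun i => grid_cell (ltn_ord i))) _.
  under eq_bigr do rewrite scalerDl.
  rewrite big_split/=; apply: riesz_leD.
    apply: (rpowP f0).1; exists N, t, a; split=> // i s _; exact: a_le.
  rewrite -scaler_sumr; apply: riesz_scale_le; first by rewrite divr_ge0.
  rewrite (eq_bigr (fun i : 'I_N =>
    mul e (spectral e f (t i.+1) - spectral e f (t i)))).
    rewrite (sum_mul_spectralB hmul) (falg_mul1x hmul); exact: (spectralB_le1 hmul dcU).
  by move=> i _; rewrite (falg_mul1x hmul).
have zE : z = mul z c + mul z (spectral e f (t N)).
  by rewrite -(falg_mulDr hmul) /c subrK (falg_mulx1 hmul).
have zF : z - F <= mul z c + (12 / m%:R) *: e.
  by rewrite riesz_lerBlDr {1}zE -addrA [_ *: e + F]addrC; apply: riesz_leD.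
apply: le_trans (riesz_scale_le (ltW m0R) zF) _.
rewrite scalerDr scalerA mulrCA mulfV ?gt_eqF// mulr1; exact: riesz_leD.
Qed.

End Grid.

(** The right-hand side of [grid_bound] does not depend on [m], so that the
    Archimedean property applies. *)
Lemma le_rpow f z : 0 <= f ->
  (forall s : R, 0 < s -> z <= touch_lead p s *: mul f f + touch_const p s *: e) ->
  z <= rpow e f p.
Proof.
move=> f0 zle; rewrite -[X in _ <= X]add0r -riesz_lerBlDr.
apply: (riesz_archimedean dcU (y := mul (rabs z) f + (12 : R) *: e)) => -[|m].
  rewrite scale0r riesz_addr_ge0 ?riesz_scale_ge0 ?(falg_mul_ge0 hmul)//.
    exact: rabs_ge0.
  exact: (falg_one_ge0 hmul).
exact: grid_bound.
Qed.

Lemma rpow_rabs_le x s : 0 < s ->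
  rpow e (rabs x) p <= touch_lead p s *: mul x x + touch_const p s *: e.
Proof.
by move=> s0; rewrite -(falg_mul_rabs hmul x); apply: (rpowP (rabs_ge0 x)).2.
Qed.

Lemma le_rpow_rabs x z :
  (forall s : R, 0 < s -> z <= touch_lead p s *: mul x x + touch_const p s *: e) ->
  z <= rpow e (rabs x) p.
Proof. by rewrite -(falg_mul_rabs hmul x); apply/le_rpow/rabs_ge0. Qed.

(** The parameter [s + t] serves both powers on the left; on the right the
    parameters [s] and [t] are free and the infima are taken one at a time. *)
Lemma rpow_clarkson x y :
  rpow e (rabs (x + y)) p + rpow e (rabs (x - y)) p
    <= (2 : R) *: (rpow e (rabs x) p + rpow e (rabs y) p).
Proof.
set F := _ + _.
have key (s t : R) : 0 < s -> 0 < t ->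
    (2^-1 : R) *: F <= (touch_lead p s *: mul x x + touch_const p s *: e)
                     + (touch_lead p t *: mul y y + touch_const p t *: e).
  move=> s0 t0; have st0 : 0 < s + t by lra.
  have le_lead (u w : R) : 0 < u -> 0 < w ->
      touch_lead p (u + w) <= touch_lead p u.
    by move=> u0 w0; apply: touch_leadD => //; exact: ltW.
  apply: (@le_trans _ _ (touch_lead p (s + t) *: (mul x x + mul y y)
                          + touch_const p (s + t) *: e)).
    apply: (@riesz_scale_leV _ _ 2) => //.
    rewrite scalerA mulfV ?scale1r ?pnatr_eq0// scalerDr scalerA mulrC -scalerA.
    rewrite -(falg_parallelogram hmul) [2 *: (_ *: e)]scaler_nat mulr2n scalerDr.
    rewrite addrACA; apply: riesz_leD; exact: rpow_rabs_le.
  rewrite addrACA -scalerDl; apply: riesz_leD.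
    rewrite scalerDr; apply: riesz_leD; apply: riesz_scale_le2;
      rewrite ?(falg_sqr_ge0 hmul) ?le_lead// addrC.
    by rewrite le_lead.
  by apply: riesz_scale_le2; [exact: (falg_one_ge0 hmul)|exact: touch_constD].
suff H : (2^-1 : R) *: F <= rpow e (rabs x) p + rpow e (rabs y) p.
  have := riesz_scale_le (ler0n R 2) H.
  by rewrite scalerA mulfV ?scale1r ?pnatr_eq0.
rewrite addrC -riesz_lerBlDr; apply: le_rpow_rabs => t t0.
rewrite riesz_lerBlDr addrC -riesz_lerBlDr; apply: le_rpow_rabs => s s0.
by rewrite riesz_lerBlDr; exact: key.
Qed.

End Powers.

Unset Implicit Arguments.
Set Strict Implicit.

Theorem theorem3p2 (R : realType) (E : rieszType R) (e : E)
  (hE : dedekind_complete E) (he : weak_order_unit e)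
  (Eu : rieszType R) (i : {linear E -> Eu}) (hEu : universal_completion i)
  (mul : Eu -> Eu -> Eu) (hmul : f_algebra mul (i e))
  (x y : Eu) (p : R) (hp1 : 1 <= p) (hp2 : p <= 2) :
  rpow (i e) (rabs (x + y)) p + rpow (i e) (rabs (x - y)) p
    <= 2 *: (rpow (i e) (rabs x) p + rpow (i e) (rabs y) p).
Proof.
have [dcU _] := ucompl_complete hEu.
exact: (rpow_clarkson hmul dcU hp1 hp2).
Qed.
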